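(* For every $S\subseteq\mathbb{N}$, the problem $\textsc{NotIn}(S)$ is polynomial-time many-one reducible to $\textsc{HomInd}(\mathcal{K}^S)$.
   Context: All graphs are finite, undirected, without multiple edges; simple means without loops. $\hom(F,G)$ counts homomorphisms; $G\equiv_{\mathcal{F}}H$ means $\hom(F,G)=\hom(F,H)$ for all $F\in\mathcal{F}$. For a graph class $\mathcal{F}$, $\textsc{HomInd}(\mathcal{F})$ is the problem of deciding, given two graphs $G,H$, whether $G\equiv_{\mathcal{F}}H$. For $S\subseteq\mathbb{N}$, $\textsc{NotIn}(S)$ is the problem of deciding, given $n\in\mathbb{N}$ encoded in unary, whether $n\notin S$. $\mathcal{K}^S=\{K_{n_1}+\dots+K_{n_r}\mid r\in\mathbb{N},\ \{n_1,\dots,n_r\}\subseteq S\}$, where $K_n$ is the complete graph on $n$ vertices and $+$ is disjoint union. *)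

(* Defs.v *)
From mathcomp Require Import all_boot.
Set Implicit Arguments. Unset Strict Implicit. Unset Printing Implicit Defensive.

(* Graphs: finite, undirected, loops allowed, no multi-edges.          *)
(* Vertices are 0 .. nv-1; adj is only meaningful on that range.       *)
Record graph := Graph { nv : nat; adj : nat -> nat -> bool }.

Definition is_undirected (G : graph) : Prop :=
  forall i j, i < nv G -> j < nv G -> adj G i j = adj G j i.

Definition hom (F G : graph) : nat :=
  #|[set f : {ffun 'I_(nv F) -> 'I_(nv G)} |
      [forall i : 'I_(nv F), forall j : 'I_(nv F),
         adj F i j ==> adj G (f i) (f j)]]|.

Definition K (n : nat) : graph := Graph n (fun i j => i != j).

Definition dunion (F G : graph) : graph :=
  Graph (nv F + nv G)
    (fun i j => if i < nv F then (j < nv F) && adj F i j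
                else (nv F <= j) && adj G (i - nv F) (j - nv F)).

Definition empty_graph : graph := Graph 0 (fun _ _ => false).

Definition clique_sum (ns : seq nat) : graph :=
  foldr (fun n F => dunion (K n) F) empty_graph ns.

Definition in_KS (S : nat -> Prop) (F : graph) : Prop :=
  exists ns : seq nat, (forall n, n \in ns -> S n) /\ F = clique_sum ns.

Definition hom_equiv (C : graph -> Prop) (G H : graph) : Prop :=
  forall F, C F -> hom F G = hom F H.

Definition lang := seq bool -> Prop.

Definition NotIn (S : nat -> Prop) : lang :=
  fun x => exists n, x = nseq n true /\ ~ S n.

Definition enc_graph (G : graph) : seq bool :=
  nseq (nv G) true ++
  false :: [seq adj G i j | i <- iota 0 (nv G), j <- iota 0 (nv G)].

Definition HomInd (C : graph -> Prop) : lang :=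
  fun x => exists G H : graph,
    [/\ is_undirected G, is_undirected H,
        x = enc_graph G ++ enc_graph H & hom_equiv C G H].

(* Deterministic single-tape Turing machines (semi-infinite tape,      *)
(* tape alphabet {blank, 0, 1}), start state ord0, halting state       *)
(* ord_max.                                                            *)
Inductive dir := DL | DR | DS.

Record TM := MkTM {
  tm_q : nat;
  tm_delta : 'I_tm_q.+1 -> option bool -> 'I_tm_q.+1 * option bool * dir }.

Record config (M : TM) := Config {
  cst : 'I_(tm_q M).+1; ctape : nat -> option bool; cpos : nat }.

Definition halted (M : TM) (c : config M) : bool := cst c == ord_max.

Definition step (M : TM) (c : config M) : config M :=
  if halted c then c else
  let: (q', s, d) := tm_delta (cst c) (ctape c (cpos c)) in
  @Config M q' (fun k => if k == cpos c then s else ctape c k)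
    (match d with DL => (cpos c).-1 | DR => (cpos c).+1 | DS => cpos c end).

Definition init (M : TM) (x : seq bool) : config M :=
  @Config M ord0 (fun k => if k < size x then Some (nth false x k) else None) 0.

Definition output_is (M : TM) (c : config M) (w : seq bool) : Prop :=
  (forall i, i < size w -> ctape c (cpos c + i) = Some (nth false w i)) /\
  ctape c (cpos c + size w) = None.

Definition computes_in_time (M : TM) (f : seq bool -> seq bool)
  (p : nat -> nat) : Prop :=
  forall x, exists t, t <= p (size x) /\
    halted (iter t (step (M:=M)) (init M x)) /\
    output_is (iter t (step (M:=M)) (init M x)) (f x).

Definition poly_time_computable (f : seq bool -> seq bool) : Prop :=
  exists (M : TM) (c : nat), computes_in_time M f (fun n => c * n ^ c + c).

Definition poly_reducible (L1 L2 : lang) : Prop :=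
  exists f : seq bool -> seq bool,
    poly_time_computable f /\ forall x, L1 x <-> L2 (f x).

(* Main.v *)
Require Import Defs.
From mathcomp Require Import all_boot zify.
From Stdlib Require Import Classical FunctionalExtensionality.
Set Implicit Arguments. Unset Strict Implicit. Unset Printing Implicit Defensive.

(** Let [P_k] denote the path on [k] vertices.  For [n >= 2] an input [1^n] is
    mapped to the complements of [P_(n-1) + P_(n-1)] and [P_n + P_(n-2)].  Draw
    the two paths as two rows, the second one starting at column 1; then
    exchanging the tails of the rows behind some column turns the first pair of
    paths into the second.  For a clique (an independent set of the paths) the
    exchange is possible behind the first column where it creates no conflict,
    and it is undone by the same exchange; it is impossible exactly for the
    clique that zigzags between the rows, which has [n] vertices and occurs in
    only one of the two graphs, depending on the parity of [n].  So the two
    graphs have the same number of homomorphisms from [K_m] iff [m <> n].  Since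
    homomorphism numbers are multiplicative over disjoint unions, they are
    equivalent over the class iff [n] is not in [S].  The case [n = 1] uses the
    empty graph and [K_1], and for [n = 0], where [K_0] separates nothing, the
    answer is hard-wired.

    Read row by row, the adjacency matrices are nearly periodic with period
    [N + 1], [N = 2n - 2], so that a Turing machine produces them by copying
    blocks of [N] or [N - 2] ones; the machine is obtained by compiling a small
    language of while programs on a tape. *)

(** * While programs and Turing machines *)

Definition tape : Type := (nat -> option bool) * nat.
Definition rd (x : tape) : option bool := x.1 x.2.
Definition upd (a : option bool * dir) (x : tape) : tape :=
  (fun k => if k == x.2 then a.1 else x.1 k,
   match a.2 with DL => x.2.-1 | DR => x.2.+1 | DS => x.2 end).

Inductive prog :=
| Act of (option bool -> option bool * dir)
| Seq of prog & prog
| If of pred (option bool) & prog & prog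
| While of pred (option bool) & prog.

Notation "p ;; q" := (Seq p q) (at level 61, right associativity).

(** The number is the exact step count of the compiled machine: one step for an action, one for each
    test, none for sequencing. *)
Inductive exec : prog -> nat -> tape -> tape -> Prop :=
| ExecAct f x : exec (Act f) 1 x (upd (f (rd x)) x)
| ExecSeq p q s t x y z :
    exec p s x y -> exec q t y z -> exec (p ;; q) (s + t) x z
| ExecIfT (c : pred _) p q t x y :
    c (rd x) -> exec p t x y -> exec (If c p q) t.+1 x y
| ExecIfF (c : pred _) p q t x y :
    ~~ c (rd x) -> exec q t x y -> exec (If c p q) t.+1 x y
| ExecWhileF (c : pred _) p x : ~~ c (rd x) -> exec (While c p) 1 x x
| ExecWhileT (c : pred _) p s t x y z :
    c (rd x) -> exec p s x y -> exec (While c p) t y z ->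
    exec (While c p) (s + t).+1 x z.

Fixpoint psize (p : prog) : nat :=
  match p with
  | Act _ => 1
  | Seq p q => psize p + psize q
  | If _ p q => (psize p + psize q).+1
  | While _ p => (psize p).+1
  end.

(* The transition table of [p] occupies the states [o, ..., o + psize p - 1];
   it is entered at [o] and left for the state [e]. *)
Fixpoint code (p : prog) (o e q : nat) (s : option bool) :
    nat * (option bool * dir) :=
  match p with
  | Act f => (e, f s)
  | Seq p1 p2 =>
      if q < o + psize p1 then code p1 o (o + psize p1) q s
      else code p2 (o + psize p1) e q s
  | If c p1 p2 =>
      if q == o then (if c s then o.+1 else o.+1 + psize p1, (s, DS))
      else if q < o.+1 + psize p1 then code p1 o.+1 e q s
      else code p2 (o.+1 + psize p1) e q s
  | While c p1 =>
      if q == o then (if c s then o.+1 else e, (s, DS))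
      else code p1 o.+1 o q s
  end.

(** The exit address [psize P] is the largest state, hence the halting one. *)
Definition compile (P : prog) : TM :=
  @MkTM (psize P) (fun i s =>
    let r := code P 0 (psize P) i s in (inord r.1, r.2.1, r.2.2)).

Definition conf (P : prog) (q : nat) (x : tape) : config (compile P) :=
  @Config (compile P) (inord q) x.1 x.2.

Lemma step_conf P q x : q < psize P ->
  step (conf P q x) =
  let r := code P 0 (psize P) q (rd x) in conf P r.1 (upd r.2 x).
Proof.
move=> ltq; rewrite /step /halted /conf /=.
have -> : (inord q == ord_max :> 'I_(psize P).+1) = false.
  by apply/eqP => /(congr1 val) /=; rewrite inordK; lia.
by rewrite inordK //; lia.
Qed.

Lemma upd_stay x : upd (rd x, DS) x = x.
Proof.
case: x => T i; congr (_, _); apply: functional_extensionality => k /=.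
by case: eqP => // ->.
Qed.

(** Induction on the execution. The last hypothesis says that the table of [P] contains the block of
    [p] at [o] with exit [e]. A loop body exits to its own test, so after one round the hypothesis
    for the remaining loop applies at the same address. *)
Lemma code_correct P p o e t x y :
  exec p t x y ->
  o + psize p <= psize P ->
  (forall q s, o <= q < o + psize p -> code P 0 (psize P) q s = code p o e q s) ->
  iter t (@step (compile P)) (conf P o x) = conf P e y.
Proof.
move=> H; elim: H o e => {p t x y} /=.
- by move=> f x o e le_o Hc; rewrite step_conf ?Hc //; lia.
- move=> p q s t x y z _ IHp _ IHq o e le_o Hc.
  rewrite addnC iterD (IHp o (o + psize p)); first last.
  + by move=> r u Hr; rewrite Hc; [case: ltnP => //; lia | lia].
  + by lia.
  by apply: IHq => [|r u Hr]; [lia | rewrite Hc; [case: ltnP => //; lia | lia]].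
- move=> c p q t x y cx _ IH o e le_o Hc.
  rewrite -iterS iterSr step_conf; last by lia.
  rewrite Hc; last by lia.
  rewrite eqxx cx /= upd_stay; apply: IH => [|r u Hr]; first by lia.
  by rewrite Hc; [case: eqP; [lia | case: ltnP => //; lia] | lia].
- move=> c p q t x y /negbTE cx _ IH o e le_o Hc.
  rewrite -iterS iterSr step_conf; last by lia.
  rewrite Hc; last by lia.
  rewrite eqxx cx /= upd_stay; apply: IH => [|r u Hr]; first by lia.
  by rewrite Hc; [case: eqP; [lia | case: ltnP => //; lia] | lia].
- move=> c p x /negbTE cx o e le_o Hc.
  rewrite step_conf; last by lia.
  by rewrite Hc ?eqxx ?cx /= ?upd_stay //; lia.
- move=> c p s t x y z cx _ IHp _ IHw o e le_o Hc.
  rewrite -iterS iterSr step_conf; last by lia.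
  rewrite Hc; last by lia.
  rewrite eqxx cx /= upd_stay addnC iterD (IHp o.+1 o); first last.
  + by move=> r u Hr; rewrite Hc; [case: eqP => //; lia | lia].
  + by lia.
  by apply: IHw.
Qed.

Lemma compile_correct P t x y :
  exec P t x y -> iter t (@step (compile P)) (conf P 0 x) = conf P (psize P) y.
Proof. by move=> H; apply: (code_correct H). Qed.

Definition runs p B x y := exists2 t, t <= B & exec p t x y.

Lemma runs_le p B B' x y : B <= B' -> runs p B x y -> runs p B' x y.
Proof. by move=> le_B [t le_t H]; exists t => //; apply: leq_trans le_B. Qed.

Lemma runs_seq p q B C x y z :
  runs p B x y -> runs q C y z -> runs (p ;; q) (B + C) x z.
Proof.
by move=> [s ? ?] [t ? ?]; exists (s + t); [lia | apply: ExecSeq; eassumption].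
Qed.

Lemma runs_ifT (c : pred _) p q B x y :
  c (rd x) -> runs p B x y -> runs (If c p q) B.+1 x y.
Proof. by move=> cx [t ? ?]; exists t.+1; [lia | apply: ExecIfT]. Qed.

Lemma runs_ifF (c : pred _) p q B x y :
  ~~ c (rd x) -> runs q B x y -> runs (If c p q) B.+1 x y.
Proof. by move=> cx [t ? ?]; exists t.+1; [lia | apply: ExecIfF]. Qed.

Lemma runs_whileF (c : pred _) p x : ~~ c (rd x) -> runs (While c p) 1 x x.
Proof. by move=> cx; exists 1 => //; apply: ExecWhileF. Qed.

(** The premise is a sequence, so that [runs_seq] can add the costs of one round and of the
    remaining loop. *)
Lemma runs_whileT (c : pred _) p B x y :
  c (rd x) -> runs (p ;; While c p) B x y -> runs (While c p) B.+1 x y.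
Proof.
move=> cx [t le_t H]; inversion H; subst.
by exists (s + t0).+1; [lia | apply: ExecWhileT; eassumption].
Qed.

(** * Tapes split at the head position *)

Definition Z (L R : seq (option bool)) : tape := (nth None (L ++ R), size L).

Lemma rd_Z L R : rd (Z L R) = head None R.
Proof. by rewrite /rd /= nth_cat ltnn subnn nth0. Qed.

(** Lists that differ only in trailing blanks denote the same tape. *)
Lemma Z_eq L R R' : nth None R =1 nth None R' -> Z L R = Z L R'.
Proof.
move=> eqR; congr (_, _); apply: functional_extensionality => k.
by rewrite !nth_cat eqR.
Qed.

Lemma upd_DS s L R : upd (s, DS) (Z L R) = Z L (s :: behead R).
Proof.
congr (_, _); apply: functional_extensionality => k /=.
rewrite !nth_cat; case: (ltngtP k (size L)) => // [lt_k|->]; last by rewrite subnn.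
by rewrite -(subnKC lt_k) addSn -addnS addKn /= nth_behead.
Qed.

Lemma upd_DR s L R : upd (s, DR) (Z L R) = Z (rcons L s) (behead R).
Proof. by case: (upd_DS s L R) => eqT; rewrite /upd /Z /= eqT size_rcons cat_rcons. Qed.

Lemma upd_DL s L a R :
  upd (s, DL) (Z (rcons L a) R) = Z L (a :: s :: behead R).
Proof.
case: (upd_DS s (rcons L a) R) => eqT.
by rewrite /upd /Z /= -cat_rcons -eqT size_rcons.
Qed.

Definition MR := Act (fun s => (s, DR)).
Definition ML := Act (fun s => (s, DL)).
Definition WR s := Act (fun _ => (s, DR)).

Lemma runs_MR L s R : runs MR 1 (Z L (s :: R)) (Z (rcons L s) R).
Proof.
exists 1 => //; have := ExecAct (fun s => (s, DR)) (Z L (s :: R)).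
by rewrite rd_Z upd_DR.
Qed.

Lemma runs_MR0 L : runs MR 1 (Z L [::]) (Z (rcons L None) [::]).
Proof.
exists 1 => //; have := ExecAct (fun s => (s, DR)) (Z L [::]).
by rewrite rd_Z upd_DR.
Qed.

Lemma runs_ML L a R : runs ML 1 (Z (rcons L a) R) (Z L (a :: R)).
Proof.
exists 1 => //; have := ExecAct (fun s => (s, DL)) (Z (rcons L a) R).
rewrite rd_Z upd_DL; congr exec; apply: Z_eq => -[|k] //=.
by case: R => //; case: k => //= k; rewrite nth_nil.
Qed.

Lemma runs_WR s L R : runs (WR s) 1 (Z L R) (Z (rcons L s) (behead R)).
Proof.
exists 1 => //; have := ExecAct (fun _ => (s, DR)) (Z L R).
by rewrite upd_DR.
Qed.

Lemma runs_right (c : pred (option bool)) L l R :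
  all c l -> ~~ c (head None R) ->
  runs (While c MR) (2 * size l).+1 (Z L (l ++ R)) (Z (L ++ l) R).
Proof.
elim: l L => [|a l IH] L /=.
  by rewrite cats0 => _ cR; apply: runs_whileF; rewrite rd_Z.
case/andP=> ca cl cR; apply: (@runs_le _ (1 + (2 * size l).+1).+1); first by lia.
apply: runs_whileT; first by rewrite rd_Z.
by rewrite -cat_rcons; apply: runs_seq (runs_MR _ _ _) (IH _ cl cR).
Qed.

(** The first move is unconditional because the head may start on a cell that fails [c]. *)
Definition back c := ML ;; While c ML.

Lemma runs_back (c : pred (option bool)) L a l R :
  all c l -> ~~ c a ->
  runs (back c) (2 * size l).+2 (Z (rcons L a ++ l) R) (Z L (a :: l ++ R)).
Proof.
elim/last_ind: l R => [|l b IH] R.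
  move=> _ ca; rewrite cats0; apply: (runs_seq (runs_ML _ _ _)).
  by apply: runs_whileF; rewrite rd_Z.
rewrite all_rcons => /andP[cb cl] ca; rewrite -rcons_cat (cat_rcons b) size_rcons.
apply: (@runs_le _ (1 + (2 * size l).+3)); first by lia.
apply: (runs_seq (runs_ML _ _ _)); apply: runs_whileT; first by rewrite rd_Z.
exact: IH.
Qed.

(** * Tape routines *)

Definition nonblank (s : option bool) : bool := s != None.
Definition is_one (s : option bool) : bool := s == Some true.
Definition is_zero (s : option bool) : bool := s == Some false.

Definition to_blank := While nonblank MR.

Lemma all_nonblank w : all nonblank (map Some w).
Proof. by rewrite all_map; apply/allP. Qed.

Lemma runs_to_blank L w :
  runs to_blank (2 * size w + 1) (Z L (map Some w)) (Z (L ++ map Some w) [::]).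
Proof.
have := @runs_right nonblank L (map Some w) [::] (all_nonblank w) isT.
by rewrite cats0 size_map addn1.
Qed.

Lemma runs_back_nonblank L w :
  runs (back nonblank) (2 * size w + 2) (Z (rcons L None ++ map Some w) [::])
    (Z L (None :: map Some w)).
Proof.
have := @runs_back nonblank L None (map Some w) [::] (all_nonblank w) isT.
by rewrite cats0 size_map addn2.
Qed.

Definition copy_one :=
  WR None ;; to_blank ;; WR (Some true) ;; back nonblank ;; WR (Some true).

(* The blank written over the cell being copied marks the place to return to. *)
Lemma runs_copy_one L w :
  runs copy_one (4 * size w + 8) (Z L (Some true :: map Some w))
    (Z (rcons L (Some true)) (map Some (rcons w true))).
Proof.
apply: (@runs_le _ (1 + ((2 * size w + 1) + (1 + ((2 * (size w).+1 + 2) + 1))))).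
  by lia.
apply: (runs_seq (runs_WR _ _ _)) => /=.
apply: (runs_seq (runs_to_blank _ _)); apply: (runs_seq (runs_WR _ _ _)).
rewrite rcons_cat -map_rcons -[(size w).+1](size_rcons w true).
by apply: (runs_seq (runs_back_nonblank _ _)); apply: runs_WR.
Qed.

Lemma runs_copy_loop L j w :
  runs (While is_one copy_one) (j * (4 * (j + size w).+1 + 8) + j.+1)
    (Z L (map Some (nseq j true ++ false :: w)))
    (Z (L ++ nseq j (Some true)) (map Some (false :: w ++ nseq j true))).
Proof.
(* [k] counts the ones still to be copied. A round passes one cell and appends one, so the length
   ahead stays constant and a single [B] bounds all rounds. *)
suff H k : forall B, 4 * (j + size w) + 8 <= B -> k <= j ->
  runs (While is_one copy_one) (k * B.+1 + 1)
    (Z (L ++ nseq (j - k) (Some true))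
       (map Some (nseq k true ++ false :: w ++ nseq (j - k) true)))
    (Z (L ++ nseq j (Some true)) (map Some (false :: w ++ nseq j true))).
  have := H j (4 * (j + size w).+1 + 8); rewrite subnn !cats0 => H'.
  by apply: runs_le (H' _ _); nia.
elim: k => [|k IH] B le_B le_k.
  by rewrite subn0; apply: runs_whileF; rewrite rd_Z.
apply: (@runs_le _ (B + (k * B.+1 + 1)).+1); first by nia.
apply: runs_whileT; first by rewrite rd_Z.
apply: runs_seq (IH _ le_B (ltnW le_k)).
apply: runs_le (_ : runs _ (4 * (j + size w) + 8) _ _) => //.
have -> : nseq (j - k) (Some true) = rcons (nseq (j - k.+1) (Some true)) (Some true).
  by rewrite -cats1 -(nseqD _ 1) addn1 subnSK.
have -> : nseq (j - k) true = rcons (nseq (j - k.+1) true) true.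
  by rewrite -cats1 -(nseqD _ 1) addn1 subnSK.
have := runs_copy_one (L ++ nseq (j - k.+1) (Some true))
  (nseq k true ++ false :: w ++ nseq (j - k.+1) true).
rewrite !rcons_cat rcons_cons rcons_cat; apply: runs_le.
by rewrite !(size_cat, size_nseq) /= size_cat size_nseq; lia.
Qed.

(* [p] unread and [q] read cells of the unary counter, then the output [w];
   the head is on the blank behind the output. *)
Definition work p q w :=
  Z (None :: nseq p (Some true) ++ nseq q (Some false) ++ None :: map Some w) [::].

Lemma workE p q w : work p q w =
  Z (rcons (None :: nseq p (Some true) ++ nseq q (Some false)) None ++ map Some w) [::].
Proof. by rewrite /work cat_rcons /= -catA. Qed.

Lemma runs_emit b p q w : runs (WR (Some b)) 1 (work p q w) (work p q (rcons w b)).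
Proof.
have := runs_WR (Some b) (None :: nseq p (Some true) ++ nseq q (Some false)
  ++ None :: map Some w) [::].
by rewrite rcons_cons !rcons_cat rcons_cons -map_rcons.
Qed.

(** [skip] passes the separator and the ones to be left out; the loop copies the rest of the leading
    block of ones and stops at the zero behind it, before reaching the copies. *)
Definition copy skip := back nonblank ;; skip ;; While is_one copy_one ;; to_blank.

(** Ends on the last unread counter cell, or on the blank in front of the counter if none is
    left. *)
Definition seek := back nonblank ;; back is_zero.

Definition mark := WR (Some false) ;; to_blank ;; MR ;; to_blank.

Definition restore :=
  MR ;; While nonblank (WR (Some true)) ;; MR ;; to_blank.

(** The counter is consumed from right to left. [restore] also revives cells marked before the loop,
    so a [mark] beforehand saves one round without shortening the counter for later loops. *)
Definition for_each body := seek ;; While is_one (mark ;; body ;; seek) ;; restore.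

Lemma runs_to_output p q w : 
  runs (back nonblank) (2 * size w + 2) (work p q w)
    (Z (None :: nseq p (Some true) ++ nseq q (Some false)) (None :: map Some w)).
Proof. by rewrite workE; apply: runs_back_nonblank. Qed.

Lemma runs_from_output p q w1 w2 :
  runs to_blank (2 * size w2 + 1)
    (Z (None :: nseq p (Some true) ++ nseq q (Some false) ++ None :: map Some w1)
       (map Some w2))
    (work p q (w1 ++ w2)).
Proof.
have -> : work p q (w1 ++ w2) = Z ((None :: nseq p (Some true) ++
  nseq q (Some false) ++ None :: map Some w1) ++ map Some w2) [::].
  by rewrite /work map_cat /= -!catA.
exact: runs_to_blank.
Qed.

Lemma runs_copy k skip B p q j w :
  (forall L s R, runs skip B (Z L (s :: nseq k (Some true) ++ R))
                   (Z (rcons L s ++ nseq k (Some true)) R)) ->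
  runs (copy skip) (B + j * (4 * (j + size w).+1 + 8) + 5 * (k + j + size w) + 10)
    (work p q (nseq (k + j) true ++ false :: w))
    (work p q (nseq (k + j) true ++ false :: w ++ nseq j true)).
Proof.
move=> skipP; set M := j * _.
apply: (@runs_le _ ((2 * (k + j + (size w).+1) + 2) + (B + ((M + j.+1) +
  (2 * (size w + j).+1 + 1))))); first by lia.
have -> : k + j + (size w).+1 = size (nseq (k + j) true ++ false :: w).
  by rewrite size_cat size_nseq.
apply: (runs_seq (runs_to_output _ _ _)); rewrite nseqD -!catA map_cat map_nseq.
apply: (runs_seq (skipP _ _ _)); apply: (runs_seq (runs_copy_loop _ _ _)).
have := runs_from_output p q (nseq k true ++ nseq j true) (false :: w ++ nseq j true).
by rewrite /= size_cat size_nseq map_cat !map_nseq -!cats1 -!catA.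
Qed.

Lemma runs_seek1 p q w :
  runs seek (2 * (q + size w) + 4) (work p.+1 q w)
    (Z (None :: nseq p (Some true))
       (Some true :: nseq q (Some false) ++ None :: map Some w)).
Proof.
apply: (@runs_le _ ((2 * size w + 2) + (2 * q).+2)); first by lia.
apply: (runs_seq (runs_to_output _ _ _)).
have -> : None :: nseq p.+1 (Some true) ++ nseq q (Some false) =
  rcons (None :: nseq p (Some true)) (Some true) ++ nseq q (Some false).
  by rewrite -cats1 /= -(nseqD _ 1) addn1.
rewrite -[X in 2 * X](size_nseq q (Some false)).
by apply: runs_back => //; rewrite all_nseq orbT.
Qed.

Lemma runs_seek0 q w :
  runs seek (2 * (q + size w) + 4) (work 0 q w)
    (Z [::] (None :: nseq q (Some false) ++ None :: map Some w)).
Proof.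
apply: (@runs_le _ ((2 * size w + 2) + (2 * q).+2)); first by lia.
apply: (runs_seq (runs_to_output _ _ _)).
rewrite -[X in 2 * X](size_nseq q (Some false)).
have := @runs_back is_zero [::] None (nseq q (Some false)).
by apply => //; rewrite all_nseq orbT.
Qed.

Lemma runs_mark p q w :
  runs mark (2 * (q + size w) + 4)
    (Z (None :: nseq p (Some true))
       (Some true :: nseq q (Some false) ++ None :: map Some w))
    (work p q.+1 w).
Proof.
apply: (@runs_le _ (1 + ((2 * q).+1 + (1 + (2 * size w + 1))))); first by lia.
apply: (runs_seq (runs_WR _ _ _)) => /=.
have := @runs_right nonblank (rcons (None :: nseq p (Some true)) (Some false))
  (nseq q (Some false)) (None :: map Some w).
rewrite all_nseq orbT size_nseq => /(_ isT isT) H; apply: (runs_seq H).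
apply: (runs_seq (runs_MR _ _ _)).
by have := runs_from_output p q.+1 [::] w; rewrite /= rcons_cat -!cats1 -!catA.
Qed.

Lemma runs_restore q w :
  runs restore (2 * (q + size w) + 4)
    (Z [::] (None :: nseq q (Some false) ++ None :: map Some w)) (work q 0 w).
Proof.
apply: (@runs_le _ (1 + ((2 * q).+1 + (1 + (2 * size w + 1))))); first by lia.
apply: (runs_seq (runs_MR _ _ _)); rewrite [rcons _ _]/=.
have rewrite_ones L R r : runs (While nonblank (WR (Some true))) (2 * r).+1
    (Z L (nseq r (Some false) ++ None :: R)) (Z (L ++ nseq r (Some true)) (None :: R)).
  elim: r L => [|r IH] L; first by rewrite cats0; apply: runs_whileF; rewrite rd_Z.
  apply: (@runs_le _ (1 + (2 * r).+1).+1); first by lia.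
  apply: runs_whileT; first by rewrite rd_Z.
  by apply: (runs_seq (runs_WR _ _ _)); rewrite /= -(cat_rcons (Some true)); apply: IH.
apply: (runs_seq (rewrite_ones _ _ _)); apply: (runs_seq (runs_MR _ _ _)).
by have := runs_from_output q 0 [::] w; rewrite /= -cats1.
Qed.

Lemma runs_for_each body D p q w v :
  (forall p' q' k, k < p ->
     runs body D (work p' q' (w ++ flatten (nseq k v)))
       (work p' q' (w ++ flatten (nseq k.+1 v)))) ->
  runs (for_each body) (p.+2 * (D + 4 * (p + q + size w + p * size v) + 10))
    (work p q w) (work (p + q) 0 (w ++ flatten (nseq p v))).
Proof.
move=> bodyP.
set M := p + q + size w + p * size v.
have sz k : k <= p -> size (w ++ flatten (nseq k v)) = size w + k * size v.
  move=> _; rewrite size_cat size_flatten /shape map_nseq sumn_nseq; lia.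
(* [r] is the number of rounds left. Including the initial [seek] lets the induction start and end
   on configurations of the form [work]. *)
suff H r : r <= p -> runs (seek ;; While is_one (mark ;; body ;; seek))
    ((2 * M + 4) + (r * (D + 4 * M + 9) + 1))
    (work r (p - r + q) (w ++ flatten (nseq (p - r) v)))
    (Z [::] (None :: nseq (p + q) (Some false) ++ None ::
              map Some (w ++ flatten (nseq p v)))).
  have := H p (leqnn p); rewrite subnn cats0 => -[t le_t Ht].
  have [t' le_t' Ht'] := runs_restore (p + q) (w ++ flatten (nseq p v)).
  inversion Ht; subst; exists (s + (t0 + t')).
    rewrite sz // in le_t'; rewrite /M in le_t *; nia.
  by apply: ExecSeq; [eassumption | apply: ExecSeq; eassumption].
elim: r => [|r IH] le_r.
  rewrite subn0; apply: runs_seq.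
    by apply: runs_le (runs_seek0 _ _); rewrite sz // /M; lia.
  by apply: runs_whileF; rewrite rd_Z.
apply: runs_seq.
  by apply: runs_le (runs_seek1 _ _ _); rewrite sz ?leq_subr // /M; nia.
apply: (@runs_le _ ((2 * M + 4) + (D + ((2 * M + 4) + (r * (D + 4 * M + 9) + 1)))).+1).
  by nia.
apply: runs_whileT; first by rewrite rd_Z.
have [t' le_t' Ht'] := IH (ltnW le_r).
(* The initial [seek] of the remaining run is the final [seek] of the current round, so the run is
   taken apart and regrouped. *)
inversion Ht' as [|p1 q1 s t x y z Hs Hw| | | |]; subst.
have [t1 le1 H1] := runs_mark r (p - r.+1 + q) (w ++ flatten (nseq (p - r.+1) v)).
have [|t2 le2 H2] := bodyP r (p - r.+1 + q).+1 (p - r.+1); first by lia.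
rewrite -addSn subnSK // in H2.
exists (t1 + (t2 + s) + t).
  by rewrite sz ?leq_subr // in le1; rewrite /M in le_t' *; nia.
rewrite -addSn subnSK // in H1.
exact: (ExecSeq (ExecSeq H1 (ExecSeq H2 Hs)) Hw).
Qed.

(** * Writing the two matrices *)

(** Skipping the separator and two of the [2 + 2 * b] leading ones leaves [2 * b] ones to copy. *)
Definition wblock :=
  WR (Some false) ;; copy (MR ;; MR ;; MR) ;; WR (Some false) ;; WR (Some false).

(** The entries behind a diagonal entry up to and including the next one, for consecutive vertices
    of a path: the two zeros next to the ones are the missing edge, the last is the diagonal. *)
Definition wstr b := false :: nseq (2 * b) true ++ [:: false; false].
Definition head_str b w := nseq (2 + 2 * b) true ++ false :: w.

(** One bound for every stage of [build], so that the total time is a number of stages times it. *)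
Definition stage_time M := M.+2 * (4 * M * M + 30 * M + 40).

Lemma runs_stage p q k M x y z :
  runs p (stage_time M) x y -> runs q (k * stage_time M) y z ->
  runs (p ;; q) (k.+1 * stage_time M) x z.
Proof. by rewrite mulSn; apply: runs_seq. Qed.

Lemma head_str_rcons b w c : rcons (head_str b w) c = head_str b (rcons w c).
Proof. by rewrite /head_str rcons_cat. Qed.

Lemma head_str_cat b w v : head_str b w ++ v = head_str b (w ++ v).
Proof. by rewrite /head_str -catA. Qed.

Lemma size_head_str b w : size (head_str b w) = 2 * b + size w + 3.
Proof. by rewrite size_cat size_nseq /=; lia. Qed.

Lemma runs_emit_stage c M p q w :
  runs (WR (Some c)) (stage_time M) (work p q w) (work p q (rcons w c)).
Proof. by apply: runs_le (runs_emit _ _ _ _); rewrite /stage_time; lia. Qed.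

Lemma runs_copy_stage p q b w M : 2 * b + size w + 5 <= M ->
  runs (copy MR) (stage_time M) (work p q (head_str b w))
    (work p q (head_str b (w ++ nseq (2 + 2 * b) true))).
Proof.
move=> le_M; apply: runs_le (@runs_copy 0 MR 1 p q (2 + 2 * b) w _).
  by rewrite /stage_time; nia.
by move=> L s R; rewrite cats0; apply: runs_MR.
Qed.

Lemma runs_wblock p q b w M : 2 * b + size w + 5 <= M ->
  runs wblock (4 * M * M + 17 * M + 20) (work p q (head_str b w))
    (work p q (head_str b (w ++ wstr b))).
Proof.
move=> le_M.
apply: (@runs_le _ (1 + ((3 + 2 * b * (4 * (2 * b + (size w).+1).+1 + 8) +
  5 * (2 + 2 * b + (size w).+1) + 10) + (1 + 1)))); first by nia.
apply: (runs_seq (runs_emit _ _ _ _)); rewrite head_str_rcons.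
rewrite -(size_rcons w false); apply: runs_seq.
  apply: (@runs_copy 2) => L s R; rewrite -!cat_rcons cats0.
  by do 2!apply: (@runs_seq _ _ 1 _ _ _ _ (runs_MR _ _ _)); apply: runs_MR.
apply: (runs_seq (runs_emit _ _ _ _)).
have -> : head_str b (w ++ wstr b) =
  rcons (rcons (head_str b (rcons w false ++ nseq (2 * b) true)) false) false.
  by rewrite !head_str_rcons cat_rcons -!cats1 -!catA.
exact: runs_emit.
Qed.

Lemma runs_for_wblock p q b w M : p + q + 2 * b + size w + p * (2 * b + 3) + 5 <= M ->
  runs (for_each wblock) (stage_time M) (work p q (head_str b w))
    (work (p + q) 0 (head_str b (w ++ flatten (nseq p (wstr b))))).
Proof.
move=> le_M.
have sz : size (wstr b) = 2 * b + 3 by rewrite /= size_cat size_nseq addn2 addn3.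
have := @runs_for_each wblock (4 * M * M + 17 * M + 20) p q (head_str b w) (wstr b).
rewrite head_str_cat => H; apply: runs_le (H _).
  rewrite size_head_str sz /stage_time; apply: leq_mul; lia.
move=> p' q' k lt_k.
have -> : flatten (nseq k.+1 (wstr b)) = flatten (nseq k (wstr b)) ++ wstr b.
  by rewrite -addn1 nseqD flatten_cat /= cats0.
rewrite !head_str_cat catA.
apply: runs_wblock; rewrite size_cat size_flatten /shape map_nseq sumn_nseq sz; nia.
Qed.

Lemma runs_for_template b M : 4 * b + 10 <= M ->
  runs (for_each (WR (Some true) ;; WR (Some true))) (stage_time M)
    (work b.+1 0 [::]) (work b.+1 0 (nseq (2 + 2 * b) true)).
Proof.
move=> le_M.
have ones k : flatten (nseq k [:: true; true]) = nseq (2 * k) true.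
  by elim: k => // k IH; rewrite mulnS nseqD -IH.
have := @runs_for_each (WR (Some true) ;; WR (Some true)) 2 b.+1 0 [::] [:: true; true].
rewrite addn0 cat0s ones mulnS => H.
apply: runs_le (H _); first by rewrite /stage_time; apply: leq_mul; [lia | rewrite /=; lia].
move=> p q k _; rewrite !ones; apply: (runs_seq (runs_emit _ _ _ _)).
have -> : nseq (2 * k.+1) true = rcons (rcons (nseq (2 * k) true) true) true.
  by rewrite mulnS addnC nseqD -!cats1 -catA.
exact: runs_emit.
Qed.

Lemma runs_seek1_stage p q w M : q + size w <= M ->
  runs seek (stage_time M) (work p.+1 q w)
    (Z (None :: nseq p (Some true))
       (Some true :: nseq q (Some false) ++ None :: map Some w)).
Proof. by move=> le_M; apply: runs_le (runs_seek1 _ _ _); rewrite /stage_time; nia. Qed.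

Lemma runs_mark_stage p q w M : q + size w <= M ->
  runs mark (stage_time M)
    (Z (None :: nseq p (Some true))
       (Some true :: nseq q (Some false) ++ None :: map Some w))
    (work p q.+1 w).
Proof. by move=> le_M; apply: runs_le (runs_mark _ _ _); rewrite /stage_time; nia. Qed.

(** The counter holds [b.+1]. The first loop writes the vertex number, which then serves as the
    template of all copies. The two zeros end it and give the first diagonal entry. Each [mark]
    before a loop reduces its rounds by one: [b] blocks, a cut and [b] blocks for the first graph,
    then [b.+1] blocks, a cut and [b - 1] blocks for the second. The final test catches [b = 0],
    where the second graph has no cut. *)
Definition build :=
  for_each (WR (Some true) ;; WR (Some true)) ;; WR (Some false) ;;
  WR (Some false) ;; seek ;; mark ;; for_each wblock ;;
  copy MR ;; WR (Some false) ;; seek ;; mark ;; for_each wblock ;;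
  copy MR ;; WR (Some false) ;; WR (Some false) ;; for_each wblock ;;
  seek ;; mark ;; seek ;;
  If is_one (mark ;; copy MR ;; WR (Some false) ;; for_each wblock) restore.

(** The counterpart of [wstr] between the last vertex of one path and the first of the other, where
    the edge is present. *)
Definition cut_str b := nseq (2 + 2 * b) true ++ [:: false].
Definition wstrs b k := flatten (nseq k (wstr b)).

Definition reduct_str b : seq bool :=
  head_str b (false :: wstrs b b ++ cut_str b ++ wstrs b b) ++
  head_str b (false :: wstrs b b.+1 ++
    if b is k.+1 then cut_str b ++ wstrs b k else [::]).

Lemma size_wstrs b k : size (wstrs b k) = k * (2 * b + 3).
Proof.
by rewrite size_flatten /shape map_nseq sumn_nseq /= size_cat size_nseq /=; lia.
Qed.

Lemma size_cut_str b : size (cut_str b) = 2 * b + 3.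
Proof. by rewrite size_cat size_nseq /=; lia. Qed.

Lemma runs_build b M : 20 * b.+1 * b.+1 + 20 <= M ->
  exists p q, runs build (25 * stage_time M) (work b.+1 0 [::])
    (work p q (reduct_str b)).
Proof.
move=> le_M.
pose w1 := false :: wstrs b b.
pose w2 := w1 ++ cut_str b ++ wstrs b b.
pose w3 := w2 ++ cut_str b ++ false :: wstrs b b.+1.
have s1 : size w1 = b * (2 * b + 3) + 1 by rewrite /= size_wstrs; lia.
have size_app u l : size (u ++ cut_str b ++ l) = size u + (2 * b + 3) + size l.
  by rewrite size_cat [X in _ + X]size_cat size_cut_str addnA.
have s2 : size w2 = size w1 + (2 * b + 3) + b * (2 * b + 3).
  by rewrite size_app size_wstrs.
have s3 : size w3 = size w2 + (2 * b + 4) + b.+1 * (2 * b + 3).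
  rewrite size_app -[b.+1 * _]size_wstrs.
  by move: (wstrs b b.+1) (size w2) => l k; rewrite /=; lia.
have m1 : size w1 + 10 * b + 10 <= M by nia.
have m2 : size w2 + 10 * b + 10 <= M by nia.
have m3 : size w3 + 10 * b + 10 <= M by nia.
have m4 : size w3 + 10 * b + b * (2 * b + 3) + 10 <= M by nia.
have cut_rcons w : rcons (head_str b (w ++ nseq (2 + 2 * b) true)) false =
                   head_str b (w ++ cut_str b).
  by rewrite head_str_rcons /cut_str catA cats1.
(* The first 17 stages are the same for all [b]; only the remainder distinguishes [b = 0]. *)
suff [p [q [k le_k H]]] : exists p q, exists2 k, k <= 6 &
    runs (seek ;; If is_one (mark ;; copy MR ;; WR (Some false) ;; for_each wblock)
         restore) (k * stage_time M)
      (work b 1 (head_str b w3)) (work p q (reduct_str b)).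
  exists p, q; apply: (@runs_le _ ((17 + k) * stage_time M)); first by nia.
  apply: runs_stage; first by apply: runs_for_template; lia.
  apply: (runs_stage (runs_emit_stage _ _ _ _ _)).
  apply: (runs_stage (runs_emit_stage _ _ _ _ _)).
  rewrite -!cats1 -catA -/(head_str b [:: false]).
  apply: runs_stage; first by apply: runs_seek1_stage; rewrite size_head_str /=; lia.
  apply: runs_stage; first by apply: runs_mark_stage; rewrite size_head_str /=; lia.
  apply: runs_stage; first by apply: runs_for_wblock; rewrite /=; lia.
  rewrite -[[:: false] ++ _]/w1 addn1.
  apply: runs_stage; first by apply: runs_copy_stage; lia.
  apply: (runs_stage (runs_emit_stage _ _ _ _ _)); rewrite cut_rcons.
  have s1' : size (w1 ++ cut_str b) = size w1 + (2 * b + 3).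
    by rewrite size_cat size_cut_str.
  apply: runs_stage; first by apply: runs_seek1_stage; rewrite size_head_str s1'; lia.
  apply: runs_stage; first by apply: runs_mark_stage; rewrite size_head_str s1'; lia.
  apply: runs_stage; first by apply: runs_for_wblock; rewrite s1'; lia.
  rewrite -/(wstrs b b) -catA -/w2 addn1.
  apply: runs_stage; first by apply: runs_copy_stage; lia.
  apply: (runs_stage (runs_emit_stage _ _ _ _ _)); rewrite cut_rcons.
  apply: (runs_stage (runs_emit_stage _ _ _ _ _)); rewrite head_str_rcons.
  apply: runs_stage; first apply: runs_for_wblock.
    by rewrite size_rcons size_cat size_cut_str; lia.
  rewrite -/(wstrs b b.+1) cat_rcons -catA -/w3 addn0.
  apply: runs_stage; first by apply: runs_seek1_stage; rewrite size_head_str; lia.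
  apply: runs_stage; first by apply: runs_mark_stage; rewrite size_head_str; lia.
  by [].
(* For [b = 0] the only counter cell is marked, so [seek] ends on the blank in front and [restore]
   is run. *)
case: b => [|c] in w1 w2 w3 s1 s2 s3 m1 m2 m3 m4 size_app cut_rcons le_M *.
  exists 1, 0; exists 2 => //.
  have -> : reduct_str 0 = head_str 0 w3 by [].
  apply: runs_stage.
    apply: runs_le (runs_seek0 _ _).
    by rewrite size_head_str /stage_time; nia.
  rewrite mul1n; apply: (@runs_le _ (2 * (1 + size (head_str 0 w3)) + 4).+1).
    by rewrite size_head_str /stage_time; nia.
  by apply: runs_ifF; [rewrite rd_Z | apply: runs_restore].
set b := c.+1 in w1 w2 w3 s1 s2 s3 m1 m2 m3 m4 size_app cut_rcons le_M *.
have -> : reduct_str b = head_str b (w3 ++ cut_str b ++ wstrs b c).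
  rewrite /reduct_str head_str_cat /b -/b; congr head_str.
  have -> v : head_str b v = cut_str b ++ v by rewrite /cut_str -catA.
  rewrite /w3 /w2 /w1; move: (wstrs b b) (wstrs b b.+1) (cut_str b) => u1 u2 u3.
  by rewrite /= -!catA.
exists (c + 2), 0, 6 => //.
apply: runs_stage; first by apply: runs_seek1_stage; rewrite size_head_str; lia.
apply: (@runs_le _ (4 * stage_time M).+1); first by rewrite /stage_time; nia.
apply: runs_ifT; first by rewrite rd_Z.
apply: runs_stage; first by apply: runs_mark_stage; rewrite size_head_str; lia.
apply: runs_stage; first by apply: runs_copy_stage; lia.
apply: (runs_stage (runs_emit_stage _ _ _ _ _)); rewrite cut_rcons mul1n.
rewrite [w3 ++ cut_str b ++ _]catA; apply: runs_for_wblock.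
by rewrite size_cat size_cut_str; nia.
Qed.

(** * The reduction and its program *)

Definition rewind := back nonblank ;; MR.

Lemma runs_rewind L w :
  runs rewind (2 * size w + 3) (Z (rcons L None ++ map Some w) [::])
    (Z (rcons L None) (map Some w)).
Proof.
have -> : 2 * size w + 3 = (2 * size w + 2) + 1 by lia.
by apply: (runs_seq (runs_back_nonblank _ _)); apply: runs_MR.
Qed.

(* [z] tells whether the empty input is mapped to a yes-instance. *)
Definition reduction_prog (z : bool) :=
  If nonblank
    (If is_zero to_blank
      (WR None ;; While is_one MR ;;
       If is_zero to_blank
         (ML ;;
          If nonblank (MR ;; MR ;; build ;; rewind)
            (MR ;; WR (Some false) ;; WR (Some true) ;; WR (Some false) ;;
             WR (Some false) ;; rewind))))
    (if z then MR ;; WR (Some false) ;; WR (Some false) ;; rewind else to_blank).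

(** The empty word encodes no pair of graphs and so is a no-instance. The words for sizes 0 and 1
    encode two empty graphs, and the empty graph with [K 1]. *)
Definition reduction (z : bool) (x : seq bool) : seq bool :=
  if x == nseq (size x) true then
    match size x with
    | 0 => if z then [:: false; false] else [::]
    | 1 => [:: false; true; false; false]
    | b.+2 => reduct_str b
    end
  else [::].

(** * Polynomial time bounds *)

Definition poly_bounded (g : nat -> nat) :=
  exists c, forall n, g n <= c * n.+1 ^ c.

Lemma poly_bounded_const k : poly_bounded (fun=> k).
Proof. by exists k => n; rewrite leq_pmulr // expn_gt0. Qed.

Lemma poly_bounded_id : poly_bounded id.
Proof. by exists 1 => n; rewrite expn1 mul1n leqnSn. Qed.

Lemma poly_boundedD g h :
  poly_bounded g -> poly_bounded h -> poly_bounded (fun n => g n + h n).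
Proof.
move=> [c gP] [d hP]; exists (c + d) => n; rewrite mulnDl leq_add //.
  by apply: leq_trans (gP n) _; rewrite leq_mul // leq_pexp2l // leq_addr.
by apply: leq_trans (hP n) _; rewrite leq_mul // leq_pexp2l // leq_addl.
Qed.

Lemma poly_boundedM g h :
  poly_bounded g -> poly_bounded h -> poly_bounded (fun n => g n * h n).
Proof.
move=> [c gP] [d hP]; exists (c * d + (c + d)) => n.
apply: leq_trans (leq_mul (gP n) (hP n)) _.
rewrite mulnACA -expnD leq_mul ?leq_addr // leq_pexp2l // leq_addl //.
Qed.

(** For positive arguments the shift in the base costs a factor [2 ^ c], since [n.+2 <= 2 * n.+1];
    the additive constant covers the argument 0. *)
Lemma poly_boundedP g :
  poly_bounded g -> exists c, forall n, g n <= c * n ^ c + c.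
Proof.
move=> [c gP]; exists (c * 2 ^ c) => -[|n]; apply: leq_trans (gP _) _.
  by rewrite exp1n muln1 (leq_trans _ (leq_addl _ _)) // leq_pmulr // expn_gt0.
apply: leq_trans (leq_addr _ _); rewrite -mulnA leq_mul2l.
apply/orP; right.
apply: (@leq_trans ((2 * n.+1) ^ c)); first by case: (c) => // d; rewrite leq_exp2r //; lia.
rewrite expnMn leq_mul2l leq_pexp2l ?orbT //.
by rewrite leq_pmulr // expn_gt0.
Qed.

Definition reduction_time n :=
  25 * stage_time (20 * n * n + 20) + (2 * n + 40 * n * n + 100).

Lemma reduction_time_poly : poly_bounded reduction_time.
Proof.
have M : poly_bounded (fun n => 20 * n * n + 20).
  apply: poly_boundedD (poly_bounded_const _).
  apply: poly_boundedM poly_bounded_id.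
  exact: poly_boundedM (poly_bounded_const _) poly_bounded_id.
apply: poly_boundedD.
  apply: poly_boundedM (poly_bounded_const _) _; apply: poly_boundedM.
    by have [c cP] := poly_boundedD (poly_bounded_const 2) M; exists c.
  apply: poly_boundedD (poly_bounded_const _); apply: poly_boundedD.
    by apply: poly_boundedM (M); apply: poly_boundedM (poly_bounded_const _) M.
  exact: poly_boundedM (poly_bounded_const _) M.
apply: poly_boundedD (poly_bounded_const _).
apply: poly_boundedD; first exact: poly_boundedM (poly_bounded_const _) poly_bounded_id.
apply: poly_boundedM poly_bounded_id.
exact: poly_boundedM (poly_bounded_const _) poly_bounded_id.
Qed.

Lemma ones_prefix x : exists a y,
  x = nseq a true ++ y /\ (y = [::] \/ exists y', y = false :: y').
Proof.
elim: x => [|[] x [a [y [-> yP]]]]; first by exists 0, [::]; split; [|left].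
  by exists a.+1, y.
by exists 0, (false :: nseq a true ++ y); split; [|right; eexists].
Qed.

Lemma reduction_bad z a y :
  reduction z (nseq a true ++ false :: y) = [::].
Proof.
rewrite /reduction; case: eqP => // /(congr1 (nth true ^~ a)).
by rewrite nth_cat size_nseq ltnn subnn nth_nseq if_same.
Qed.

Lemma size_reduct_str b : size (reduct_str b) <= 20 * b.+1 * b.+1.
Proof.
rewrite size_cat !size_head_str.
case: b => [|c] //; set b := c.+1.
have sz (u v w : seq bool) : size (false :: u ++ v ++ w) = (size u + size v + size w).+1.
  by rewrite /= 2!size_cat addnA.
by rewrite !sz !size_wstrs size_cut_str; nia.
Qed.

(** Blanking the first symbol of an input of [b.+2] ones leaves a left end marker and a counter of
    [b.+1] ones. A malformed input is passed over up to a blank, where the head reads the empty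
    output. *)
Lemma runs_reduction z x : exists L,
  runs (reduction_prog z) (reduction_time (size x)) (Z [::] (map Some x))
    (Z L (map Some (reduction z x))).
Proof.
have [] := ones_prefix x => -[|a] [y [-> [->|[y' ->]]]].
- rewrite /reduction /reduction_prog; case: z => /=.
    exists [:: None]; apply: (@runs_le _ (1 + (1 + (1 + (2 * 2 + 3)))).+1); first by [].
    apply: runs_ifF; first by rewrite rd_Z.
    apply: (runs_seq (runs_MR0 _)); apply: (runs_seq (runs_WR _ _ _)).
    apply: (runs_seq (runs_WR _ _ _)).
    exact: (@runs_rewind [::] [:: false; false]).
  exists [::]; apply: (@runs_le _ (2 * 0 + 1).+1); first by [].
  apply: runs_ifF; first by rewrite rd_Z.
  exact: (runs_to_blank [::] [::]).
- rewrite (reduction_bad z 0) /=; eexists.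
  apply: (@runs_le _ (2 * size (false :: y') + 1).+2).
    by rewrite /= /reduction_time; lia.
  apply: runs_ifT; first by rewrite rd_Z.
  apply: runs_ifT; first by rewrite rd_Z.
  exact: (runs_to_blank _ (_ :: _)).
- rewrite cats0; case: a => [|b].
    exists [:: None].
    apply: (@runs_le _ (1 + (1 + (1 + (1 + (1 + (1 + (1 + (1 + (2 * 4 + 3)))))).+1).+1)).+2).
      by rewrite /reduction_time; lia.
    apply: runs_ifT; first by rewrite rd_Z.
    apply: runs_ifF; first by rewrite rd_Z.
    apply: (runs_seq (runs_WR _ _ _)).
    apply: runs_seq; first by apply: runs_whileF; rewrite rd_Z.
    apply: runs_ifF; first by rewrite rd_Z.
    apply: (runs_seq (@runs_ML [::] _ _)).
    apply: runs_ifF; first by rewrite rd_Z.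
    apply: (runs_seq (runs_MR _ _ _)).
    do 4!apply: (runs_seq (runs_WR _ _ _)).
    exact: (@runs_rewind [::] [:: false; true; false; false]).
  have -> : reduction z (nseq b.+2 true) = reduct_str b.
    by rewrite /reduction size_nseq eqxx.
  pose M := 20 * b.+1 * b.+1 + 20.
  have [p [q H]] := runs_build (leqnn M).
  eexists.
  apply: (@runs_le _ (1 + ((2 * b.+1).+1 + (1 + (1 + (1 + (25 * stage_time M +
    (2 * size (reduct_str b) + 3)))).+1).+1)).+2).
    rewrite size_nseq /reduction_time; have := size_reduct_str b.
    have : stage_time M <= stage_time (20 * b.+2 * b.+2 + 20).
      by rewrite /stage_time /M; apply: leq_mul; nia.
    move: (stage_time _) (stage_time _) => u v; nia.
  apply: runs_ifT; first by rewrite rd_Z.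
  apply: runs_ifF; first by rewrite rd_Z.
  apply: (runs_seq (runs_WR _ _ _)); rewrite [rcons [::] None]/= [behead _]/=.
  apply: (@runs_seq _ _ _ _ _ (Z (None :: nseq b.+1 (Some true)) [::])).
    have := @runs_right is_one [:: None] (nseq b.+1 (Some true)) [::].
    by rewrite cats0 size_nseq map_nseq; apply => //; rewrite all_nseq.
  apply: runs_ifF; first by rewrite rd_Z.
  have -> : None :: nseq b.+1 (Some true) = rcons (None :: nseq b (Some true)) (Some true).
    by rewrite -cats1 /= -(nseqD _ 1) addn1.
  apply: (runs_seq (runs_ML _ _ _)).
  apply: runs_ifT; first by rewrite rd_Z.
  apply: (runs_seq (runs_MR _ _ _)); apply: (runs_seq (runs_MR0 _)).
  have -> : rcons (rcons (None :: nseq b (Some true)) (Some true)) None =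
     None :: nseq b.+1 (Some true) ++ nseq 0 (Some false) ++ None :: map Some [::].
    by rewrite -!cats1 -catA /= -[[:: Some true; None]]/(nseq 1 (Some true) ++ [:: None])
      catA -nseqD addn1.
  by apply: (runs_seq H); rewrite workE; apply: runs_rewind.
- rewrite reduction_bad; eexists.
  apply: (@runs_le _ (1 + ((2 * a).+1 + (2 * size (false :: y') + 1).+1)).+2).
    by rewrite size_cat size_nseq /= /reduction_time; nia.
  apply: runs_ifT; first by rewrite rd_Z.
  apply: runs_ifF; first by rewrite rd_Z.
  apply: (runs_seq (runs_WR _ _ _)); rewrite /= map_cat map_nseq.
  apply: runs_seq.
    have := @runs_right is_one [:: None] (nseq a (Some true)) (map Some (false :: y')).
    by rewrite size_nseq; apply => //; rewrite all_nseq orbT.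
  apply: runs_ifT; first by rewrite rd_Z.
  exact: (runs_to_blank _ (_ :: _)).
Qed.

Lemma reduction_poly_time z : poly_time_computable (reduction z).
Proof.
have [c cP] := poly_boundedP reduction_time_poly.
exists (compile (reduction_prog z)), c => x.
have [L [t le_t Ht]] := runs_reduction z x.
exists t; split; first exact: leq_trans le_t (cP _).
have -> : init (compile (reduction_prog z)) x =
    conf (reduction_prog z) 0 (Z [::] (map Some x)).
  rewrite /init /conf; congr Config; first by apply: val_inj; rewrite /= inordK.
  apply: functional_extensionality => k /=; case: ltnP => lt_k.
    by rewrite (nth_map false).
  by rewrite nth_default ?size_map.
rewrite (compile_correct Ht); split.
  by rewrite /halted /=; apply/eqP/val_inj; rewrite /= inordK.
split=> [i lt_i|] /=; rewrite nth_cat ltnNge leq_addr /= addKn.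
  by rewrite (nth_map false).
by rewrite nth_default ?size_map.
Qed.

(** * Cliques in complements of two paths *)

(* The complement of the disjoint union of the paths on [0, ..., c - 1] and on
   [c, ..., N - 1]. *)
Definition cut_graph N c := Graph N (fun i j =>
  [&& i != j, (i.+1 != j) || (j == c) & (j.+1 != i) || (i == c)]).

Lemma cut_graph_undirected N c : is_undirected (cut_graph N c).
Proof. by move=> i j _ _ /=; rewrite eq_sym [X in _ && X]andbC. Qed.

(* The two paths are drawn as an upper row with columns [0, ..., c - 1] and a
   lower row with columns [1, 2, ...]. *)
Definition row c v := c <= v.
Definition column c v := if v < c then v else v - c + 1.
Definition vertex c (r : bool) j := if r then j + c - 1 else j.

Lemma vertexK c v : 0 < c -> vertex c (row c v) (column c v) = v.
Proof. by rewrite /vertex /row /column => c_gt0; case: ltnP => ?; lia. Qed.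

Lemma adj_cutE N c u v : 0 < c -> adj (cut_graph N c) u v =
  ~~ [&& row c u == row c v, column c u <= (column c v).+1
       & column c v <= (column c u).+1].
Proof.
rewrite /row /column /= => c_gt0.
by case: (ltnP u c) => ?; case: (ltnP v c) => ? /=; lia.
Qed.

(* Exchanging the rows of all columns beyond [k] turns the cut [c] into the cut
   [2 * b + 3 - c]. *)
Definition flip b c k v :=
  vertex (2 * b + 3 - c) (row c v (+) (k < column c v)) (column c v).

(* Two vertices of a clique that would not be adjacent after the exchange at [j]. *)
Definition obstructs c j u v :=
  [&& column c u == j, column c v == j.+1 & row c u != row c v].

(** The lower row ends in column [2 * b + 2 - c], so the exchanged upper row has [2 * b + 3 - c]
    vertices; this swaps the two cuts. *)
Definition central b c := (c == b.+1) || (c == b.+2).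

Lemma central_gt0 b c : central b c -> 0 < c.
Proof. by rewrite /central; lia. Qed.

Lemma central_sym b c : central b c -> central b (2 * b + 3 - c).
Proof. by rewrite /central; lia. Qed.

(** Column 0 has only an upper vertex and is never moved; column [b.+1] has a single vertex and is
    always moved; every column in between has both vertices. *)
Lemma flip_coord b c k v : central b c -> k < b.+1 -> v < (2 * b).+2 ->
  [/\ flip b c k v < (2 * b).+2,
      column (2 * b + 3 - c) (flip b c k v) = column c v &
      row (2 * b + 3 - c) (flip b c k v) = row c v (+) (k < column c v)].
Proof.
rewrite /central /flip /vertex /row /column => cc lt_k lt_v.
case: (ltnP v c) => ?; [case: (ltnP k v) | case: (ltnP k (v - c + 1))] => ? /=;
  split; rewrite ?addbT ?addbF //=; try case: ifP => ?; lia.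
Qed.

Lemma flipK b c k v : central b c -> k < b.+1 -> v < (2 * b).+2 ->
  flip b (2 * b + 3 - c) k (flip b c k v) = v.
Proof.
move=> cc lt_k lt_v; have [_ eq_col eq_row] := flip_coord cc lt_k lt_v.
rewrite {1}/flip eq_col eq_row addbK.
have -> : 2 * b + 3 - (2 * b + 3 - c) = c by rewrite /central in cc; lia.
exact/vertexK/central_gt0/cc.
Qed.

(** Columns are kept, and two vertices on the same side of the exchange keep their relative rows.
    The only pairs that can become consecutive lie in columns [k] and [k.+1] in different rows. *)
Lemma flip_adj b c k u v : central b c -> k < b.+1 ->
  u < (2 * b).+2 -> v < (2 * b).+2 ->
  ~~ obstructs c k u v -> ~~ obstructs c k v u ->
  adj (cut_graph (2 * b).+2 c) u v ->
  adj (cut_graph (2 * b).+2 (2 * b + 3 - c)) (flip b c k u) (flip b c k v).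
Proof.
move=> cc lt_k lt_u lt_v; have cc' := central_sym cc.
rewrite !adj_cutE ?(central_gt0 cc) ?(central_gt0 cc') // /obstructs.
have [_ -> ->] := flip_coord cc lt_k lt_u; have [_ -> ->] := flip_coord cc lt_k lt_v.
move: (row c u) (row c v) (column c u) (column c v) => [] [] i j;
by case: (ltnP k i); case: (ltnP k j) => /=; lia.
Qed.

(** For [j != k] the columns [j] and [j.+1] are on the same side of the exchange. *)
Lemma flip_obstructs b c k j u v : central b c -> k < b.+1 -> j != k ->
  u < (2 * b).+2 -> v < (2 * b).+2 ->
  obstructs (2 * b + 3 - c) j (flip b c k u) (flip b c k v) = obstructs c j u v.
Proof.
move=> cc lt_k neq lt_u lt_v; rewrite /obstructs.
have [_ -> ->] := flip_coord cc lt_k lt_u; have [_ -> ->] := flip_coord cc lt_k lt_v.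
move: (row c u) (row c v) (column c u) (column c v) => [] [] i i';
by case: (ltnP k i); case: (ltnP k i') => /=; lia.
Qed.

(** An obstruction at [k] after the exchange would come from vertices consecutive in one row before,
    which are not adjacent. *)
Lemma flip_obstructs_self b c k u v : central b c -> k < b.+1 ->
  u < (2 * b).+2 -> v < (2 * b).+2 -> adj (cut_graph (2 * b).+2 c) u v ->
  ~~ obstructs (2 * b + 3 - c) k (flip b c k u) (flip b c k v).
Proof.
move=> cc lt_k lt_u lt_v; rewrite adj_cutE ?(central_gt0 cc) // /obstructs.
have [_ -> ->] := flip_coord cc lt_k lt_u; have [_ -> ->] := flip_coord cc lt_k lt_v.
move: (row c u) (row c v) (column c u) (column c v) => [] [] i i';
by case: (ltnP k i); case: (ltnP k i') => /=; lia.
Qed.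

Lemma obstructs_irr c k v : ~~ obstructs c k v v.
Proof. by rewrite /obstructs eqxx !andbF. Qed.

(** * Homomorphisms from a clique: exchangeable and stuck ones *)

Section CliqueHoms.
Variables b m : nat.
Local Notation N := (2 * b).+2.
Implicit Types (c : nat) (f : {ffun 'I_m -> 'I_N}).

Definition clique_hom c f :=
  [forall i : 'I_m, forall j : 'I_m, adj (K m) i j ==> adj (cut_graph N c) (f i) (f j)].

Lemma clique_homP c f :
  reflect (forall i j, i != j -> adj (cut_graph N c) (f i) (f j)) (clique_hom c f).
Proof.
apply: (iffP forallP) => H i; first by move=> j ij; have /forallP/(_ j)/implyP := H i; apply.
by apply/forallP => j; apply/implyP; apply: H.
Qed.

Lemma hom_cliqueE c : hom (K m) (cut_graph N c) = #|[set f | clique_hom c f]|.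
Proof. by []. Qed.

Definition obstructed c f j := [exists x, exists y, obstructs c j (f x) (f y)].

Definition first_gap c f := find (fun j => ~~ obstructed c f j) (iota 0 b.+1).

Definition flippable c f := has (fun j => ~~ obstructed c f j) (iota 0 b.+1).

Definition flip_hom c f : {ffun 'I_m -> 'I_N} :=
  [ffun x => inord (flip b c (first_gap c f) (f x))].

Lemma first_gap_lt c f : flippable c f -> first_gap c f < b.+1.
Proof. by rewrite /flippable has_find size_iota. Qed.

Lemma flip_homE c f x : central b c -> flippable c f ->
  flip_hom c f x = flip b c (first_gap c f) (f x) :> nat.
Proof.
move=> cc ff; rewrite ffunE inordK //.
by have [] := flip_coord cc (first_gap_lt ff) (ltn_ord (f x)).
Qed.

Lemma first_gapP c f : flippable c f -> ~~ obstructed c f (first_gap c f).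
Proof.
move=> ff; have := nth_find 0 ff; rewrite nth_iota //; exact: first_gap_lt.
Qed.

Lemma not_obstructs c f x y : flippable c f ->
  ~~ obstructs c (first_gap c f) (f x) (f y).
Proof.
move=> /first_gapP; rewrite negb_exists => /forallP/(_ x).
by rewrite negb_exists => /forallP/(_ y).
Qed.

(** Since the exchange keeps the set of obstructed columns, it keeps the first gap, and repeating it
    at that gap undoes it. *)
Lemma flip_hom_obstructed c f j : central b c -> clique_hom c f -> flippable c f ->
  j < b.+1 -> obstructed (2 * b + 3 - c) (flip_hom c f) j = obstructed c f j.
Proof.
move=> cc /clique_homP hf ff lt_j; have lt_k := first_gap_lt ff.
apply: eq_existsb => x; apply: eq_existsb => y; rewrite !flip_homE //.
have [eq_jk|neq] := eqVneq j (first_gap c f); last exact: flip_obstructs.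
rewrite eq_jk (negbTE (not_obstructs x y ff)); apply/negbTE.
have [->|/hf] := eqVneq x y; first exact: obstructs_irr.
exact: flip_obstructs_self.
Qed.

Lemma flip_hom_flippable c f : central b c -> clique_hom c f -> flippable c f ->
  flippable (2 * b + 3 - c) (flip_hom c f).
Proof.
move=> cc hf ff; rewrite /flippable -(@eq_in_has _ (fun j => ~~ obstructed c f j)) //.
by move=> j; rewrite mem_iota => lt_j; rewrite flip_hom_obstructed.
Qed.

Lemma flip_hom_first_gap c f : central b c -> clique_hom c f -> flippable c f ->
  first_gap (2 * b + 3 - c) (flip_hom c f) = first_gap c f.
Proof.
move=> cc hf ff; apply: eq_in_find => j.
by rewrite mem_iota => lt_j; rewrite flip_hom_obstructed.
Qed.

Lemma flip_hom_hom c f : central b c -> clique_hom c f -> flippable c f ->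
  clique_hom (2 * b + 3 - c) (flip_hom c f).
Proof.
move=> cc /clique_homP hf ff; apply/clique_homP => x y neq.
rewrite !flip_homE //; apply: flip_adj => //; try exact: not_obstructs.
- exact: first_gap_lt.
- exact: hf.
Qed.

Definition flippable_homs c := [set f | clique_hom c f & flippable c f].
Definition stuck_homs c := [set f | clique_hom c f & ~~ flippable c f].

(** [flip_hom] is injective: the first gap can be read off the image, and for a fixed gap the
    exchange is invertible by [flipK]. *)
Lemma leq_card_flippable c : central b c ->
  #|flippable_homs c| <= #|flippable_homs (2 * b + 3 - c)|.
Proof.
move=> cc; rewrite -(@card_in_imset _ _ (flip_hom c)).
  apply/subset_leq_card/subsetP => _ /imsetP[f + ->]; rewrite !inE => /andP[hf ff].
  by rewrite flip_hom_hom // flip_hom_flippable.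
move=> f g; rewrite !inE => /andP[hf ff] /andP[hg fg] eq_fg.
have eq_k : first_gap c f = first_gap c g.
  by rewrite -(flip_hom_first_gap cc hf ff) eq_fg flip_hom_first_gap.
apply/ffunP => x; apply: val_inj => /=.
rewrite -[LHS](flipK cc (first_gap_lt ff) (ltn_ord (f x))) -flip_homE // eq_fg.
by rewrite flip_homE // eq_k flipK // first_gap_lt.
Qed.

Lemma card_flippable c : central b c ->
  #|flippable_homs c| = #|flippable_homs (2 * b + 3 - c)|.
Proof.
move=> cc; apply/eqP; rewrite eqn_leq leq_card_flippable //=.
have := leq_card_flippable (central_sym cc).
by have -> : 2 * b + 3 - (2 * b + 3 - c) = c by rewrite /central in cc; lia.
Qed.

Lemma card_clique_hom c :
  hom (K m) (cut_graph N c) = #|flippable_homs c| + #|stuck_homs c|.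
Proof.
rewrite hom_cliqueE -(cardsID [set f | flippable c f]); congr (_ + _).
  by apply: eq_card => f; rewrite !inE.
by apply: eq_card => f; rewrite !inE andbC.
Qed.

Lemma stuck_obstructed c f j : f \in stuck_homs c -> j < b.+1 -> obstructed c f j.
Proof.
rewrite inE => /andP[_ /hasPn/(_ j)]; rewrite mem_iota => H lt_j.
by move/negPn: (H lt_j).
Qed.

Lemma stuck_adj c f x y : central b c -> f \in stuck_homs c ->
  row c (f x) = row c (f y) -> column c (f x) = (column c (f y)).+1 -> False.
Proof.
move=> cc; rewrite inE => /andP[/clique_homP hf _] eq_row eq_col.
have [eq_xy|/hf] := eqVneq x y; first by rewrite eq_xy in eq_col; lia.
by rewrite adj_cutE ?(central_gt0 cc) // eq_row eq_col eqxx; lia.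
Qed.

(* The image of a stuck homomorphism zigzags between the rows. *)
Lemma stuck_zigzag c f j : central b c -> f \in stuck_homs c -> j < b.+2 ->
  exists2 x, row c (f x) = odd j & column c (f x) = j.
Proof.
move=> cc fU; elim: j => [|j IH] lt_j.
  have /existsP[x /existsP[y]] := stuck_obstructed fU (isT : 0 < b.+1).
  rewrite /obstructs => /and3P[/eqP col_x _ _]; exists x => //.
  by move: col_x; rewrite /column /row /=; case: ltnP; lia.
have [z row_z col_z] := IH (ltnW lt_j).
have /existsP[x /existsP[y]] := stuck_obstructed fU lt_j.
case/and3P=> /eqP col_x /eqP col_y neq; exists y => //=.
have : row c (f y) <> odd j.
  by move=> eq_row; apply: (@stuck_adj c f y z) => //; rewrite ?row_z ?col_z.
by case: (row _ _); case: (odd j).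
Qed.

(** A vertex off the zigzag in column [j.+1] would follow the zigzag vertex of column [j] in the
    same row, against adjacency. *)
Lemma stuck_on_zigzag c f x : central b c -> f \in stuck_homs c ->
  row c (f x) = odd (column c (f x)).
Proof.
move=> cc fU; have lt_fx := ltn_ord (f x).
case def_j : (column c (f x)) => [|j].
  by move: def_j; rewrite /column /row /=; case: ltnP; lia.
have lt_j : j < b.+2.
  by move: def_j; rewrite /column; case: ifP; rewrite /central in cc; lia.
have [y row_y col_y] := stuck_zigzag cc fU lt_j.
have : row c (f x) <> odd j.
  by move=> eq_row; apply: (@stuck_adj c f x y) => //; rewrite ?row_y ?col_y.
by rewrite /=; case: (row _ _); case: (odd j).
Qed.

(** Taking columns is a bijection onto the [b.+2] columns: surjective since the whole zigzag is hit,
    injective since each column has one zigzag vertex and distinct elements have adjacent images. *)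
Lemma stuck_card c f : central b c -> f \in stuck_homs c -> m = b.+2.
Proof.
move=> cc fU.
have lt_col x : column c (f x) < b.+2.
  have := ltn_ord (f x); rewrite /column; case: ifP; rewrite /central in cc; lia.
pose g x : 'I_b.+2 := inord (column c (f x)).
apply/eqP; rewrite eqn_leq; apply/andP; split.
  rewrite -(card_ord m) -[b.+2 in X in _ <= X](card_ord b.+2).
  apply: (@leq_card _ _ g) => x y /(congr1 val); rewrite /= !inordK // => eq_col.
  apply/eqP/contraT => neq.
  have [/clique_homP hf _] : clique_hom c f /\ True by move: fU; rewrite inE => /andP[].
  have := hf _ _ neq.
  rewrite adj_cutE ?(central_gt0 cc) // !(stuck_on_zigzag _ cc fU) eq_col eqxx.
  by rewrite leqnSn.
rewrite -[b.+2 in X in X <= _](card_ord b.+2) -[m in X in _ <= X](card_ord m).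
apply: leq_trans (leq_image_card g predT); apply/subset_leq_card/subsetP => j _.
have [x _ col_x] := stuck_zigzag cc fU (ltn_ord j).
by apply/imageP; exists x => //; apply: val_inj; rewrite /= inordK // col_x.
Qed.

(** The only vertex in column [b.+1] is upper for the cut [b.+2] and lower for [b.+1], while the
    zigzag prescribes its row by parity. *)
Lemma stuck_parity c f : central b c -> f \in stuck_homs c ->
  c = if odd b then b.+2 else b.+1.
Proof.
move=> cc fU; have [x] := stuck_zigzag cc fU (ltnSn b.+1).
have := ltn_ord (f x); rewrite /row /column /=; rewrite /central in cc.
by case: (odd b) => /=; case: (ltnP (f x) c) => //; lia.
Qed.

Definition zigzag c j := vertex c (odd j) j.

(** The witness sends [x] to the zigzag vertex of column [x]. Vertices in one row are at least two
    columns apart, and any two neighbouring columns give an obstruction. *)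
Lemma stuck_exists : m = b.+2 ->
  0 < #|stuck_homs (if odd b then b.+2 else b.+1)|.
Proof.
move=> eq_m; set c := (if _ then _ else _).
have cP : odd b /\ c = b.+2 \/ ~~ odd b /\ c = b.+1.
  by rewrite /c; case: (odd b); [left | right].
have c_gt0 : 0 < c by lia.
have zP j : j < b.+2 ->
    [/\ zigzag c j < N, row c (zigzag c j) = odd j & column c (zigzag c j) = j].
  rewrite /zigzag /vertex /row /column => lt_j.
  by case odd_j: (odd j); split; try case: ltnP => ?; lia.
pose f : {ffun 'I_m -> 'I_N} := [ffun x : 'I_m => inord (zigzag c x)].
have fE x : f x = zigzag c x :> nat.
  by rewrite ffunE inordK //; have [|] := zP x; rewrite -?eq_m.
apply/card_gt0P; exists f; rewrite inE; apply/andP; split.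
  apply/clique_homP => x y neq; rewrite !fE adj_cutE //.
  have : x != y :> nat by [].
  have [|_ -> ->] := zP x; first by rewrite -eq_m.
  have [|_ -> ->] := zP y; first by rewrite -eq_m.
  by case odd_x: (odd x); case odd_y: (odd y) => //=; lia.
apply/hasPn => j; rewrite mem_iota => /= lt_j; apply/negPn.
have lt1 : j < m by lia.
have lt2 : j.+1 < m by lia.
apply/existsP; exists (Ordinal lt1); apply/existsP; exists (Ordinal lt2).
rewrite !fE /obstructs /=; have [|_ -> ->] := zP j; first by lia.
have [|_ -> ->] := zP j.+1; first by lia.
by rewrite !eqxx /=; case: (odd j).
Qed.

(** The exchangeable homomorphisms cancel. Stuck ones exist only for [m = b.+2], and then for
    exactly one of the two cuts. *)
Lemma hom_clique_cut :
  hom (K m) (cut_graph N b.+1) = hom (K m) (cut_graph N b.+2) <-> m <> b.+2.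
Proof.
have c1 : central b b.+1 by rewrite /central eqxx.
have c2 : central b b.+2 by rewrite /central eqxx orbT.
rewrite !card_clique_hom (card_flippable c1).
have -> : 2 * b + 3 - b.+1 = b.+2 by lia.
have empty c : central b c -> (m <> b.+2) \/ c <> (if odd b then b.+2 else b.+1) ->
    #|stuck_homs c| = 0.
  move=> cc H; apply/eqP; rewrite cards_eq0; apply/eqP/setP => f; rewrite [RHS]inE.
  apply/negP => fU; case: H; first by have := stuck_card cc fU.
  by have := stuck_parity cc fU.
split=> [/addnI eq_stuck eq_m | neq_m]; last by rewrite !empty //; left.
have := stuck_exists eq_m; case: ifP => odd_b in empty *.
  by rewrite -eq_stuck empty //; right; lia.
by rewrite eq_stuck empty //; right; lia.
Qed.

End CliqueHoms.

(** * Encodings and homomorphism numbers *)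

(** Cutting the listing behind each diagonal entry, rather than at the row ends, gives pieces that
    are almost all equal for [cut_graph]. *)
Lemma rows_matrix (A : nat -> nat -> bool) N m : ~~ A 0 0 -> m < N ->
  [seq A i j | i <- iota 0 m.+1, j <- iota 0 N] =
  false :: flatten [seq map (A i) (iota i.+1 (N - i.+1)) ++
                        map (A i.+1) (iota 0 i.+2) | i <- iota 0 m] ++
  map (A m) (iota m.+1 (N - m.+1)).
Proof.
move=> A00; elim: m => [|m IH] lt_m.
  by case: N lt_m => //= N _; rewrite cats0 subSS subn0 (negbTE A00).
have iotaSr k : iota 0 k.+1 = rcons (iota 0 k) k by rewrite -addn1 iotaD cats1.
rewrite [iota 0 m.+2]iotaSr map_rcons flatten_rcons (IH (ltnW lt_m)) cat_cons.
rewrite [iota 0 m.+1]iotaSr map_rcons flatten_rcons -!catA; congr (_ :: _ ++ (_ ++ _)).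
by rewrite -map_cat -iotaD subnKC.
Qed.

Lemma map_const_in (T : eqType) U (g : T -> U) v s :
  {in s, forall x, g x = v} -> map g s = nseq (size s) v.
Proof.
move=> gv; have -> : map g s = map (fun=> v) s by apply/eq_in_map.
by elim: s {gv} => //= x s ->.
Qed.

Lemma cut_graph_gap b c i : i <= 2 * b ->
  map (adj (cut_graph (2 * b).+2 c) i) (iota i.+1 ((2 * b).+2 - i.+1)) ++
  map (adj (cut_graph (2 * b).+2 c) i.+1) (iota 0 i.+2) =
  if i.+1 == c then cut_str b else wstr b.
Proof.
move=> le_i; set A := adj _.
have -> : (2 * b).+2 - i.+1 = 1 + (2 * b - i) by lia.
have -> : i.+2 = i + 2 by lia.
rewrite !iotaD !map_cat add0n /=.
rewrite (@map_const_in _ _ _ true (iota (i.+1 + 1) _)); last first.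
  by move=> j; rewrite mem_iota /A /=; lia.
rewrite (@map_const_in _ _ _ true (iota 0 i)); last first.
  by move=> j; rewrite mem_iota /A /=; lia.
rewrite !size_iota.
have -> : A i i.+1 = (i.+1 == c) by rewrite /A /=; lia.
have -> : A i.+1 i = (i.+1 == c) by rewrite /A /=; lia.
have -> : A i.+1 i.+1 = false by rewrite /A /=; lia.
rewrite catA -nseqD subnK //; case: eqP => // _.
rewrite /cut_str -[[:: true; false]]/(nseq 1 true ++ [:: false]) catA -nseqD.
by rewrite -cat_cons -[true :: _]/(nseq (2 * b + 1).+1 true) addn1.
Qed.

Lemma enc_cut_graph b c : enc_graph (cut_graph (2 * b).+2 c) =
  head_str b (false :: flatten [seq if i.+1 == c then cut_str b else wstr b
                                | i <- iota 0 (2 * b).+1]).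
Proof.
rewrite /enc_graph /head_str; congr (_ ++ _ :: _).
rewrite (@rows_matrix (adj (cut_graph _ c)) (2 * b).+2 (2 * b).+1) // subnn cats0.
congr (_ :: flatten _); apply/eq_in_map => i; rewrite mem_iota => lt_i.
exact: cut_graph_gap.
Qed.

Lemma wstrs_iota b c s k : ~~ (s < c <= s + k) ->
  flatten [seq if i.+1 == c then cut_str b else wstr b | i <- iota s k] = wstrs b k.
Proof.
move=> cP; rewrite (@map_const_in _ _ _ (wstr b)) ?size_iota // => i.
by rewrite mem_iota; case: eqP => //; lia.
Qed.

Lemma wstrs_iota_cut b p r :
  flatten [seq if i.+1 == p.+1 then cut_str b else wstr b | i <- iota 0 (p + r.+1)] =
  wstrs b p ++ cut_str b ++ wstrs b r.
Proof.
rewrite iotaD map_cat flatten_cat wstrs_iota; last by lia.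
by rewrite /= eqxx wstrs_iota //; lia.
Qed.

Lemma reduct_strE b : reduct_str b =
  enc_graph (cut_graph (2 * b).+2 b.+1) ++ enc_graph (cut_graph (2 * b).+2 b.+2).
Proof.
rewrite !enc_cut_graph /reduct_str.
have {1}-> : (2 * b).+1 = b + b.+1 by lia.
rewrite wstrs_iota_cut; congr (_ ++ head_str b (_ :: _)).
(* For [b = 0] the cut [b.+2] equals the number of vertices and falls behind the only block. *)
case: b => [|k]; first by rewrite wstrs_iota // cats0.
have -> : (2 * k.+1).+1 = k.+2 + k.+1 by lia.
by rewrite wstrs_iota_cut.
Qed.

(** The unary vertex number delimits itself and fixes the length of the matrix. Adjacency outside
    the vertex range is not encoded, so the graphs agree only inside it. *)
Lemma enc_graph_inj G G' s s' : enc_graph G ++ s = enc_graph G' ++ s' ->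
  [/\ nv G = nv G', s = s' &
      forall i j, i < nv G -> j < nv G -> adj G i j = adj G' i j].
Proof.
case: G G' => n a [n' a']; rewrite /enc_graph /= -!catA /= => eq_enc.
have [eq_n {}eq_enc] : n = n' /\
  [seq a i j | i <- iota 0 n, j <- iota 0 n] ++ s =
  [seq a' i j | i <- iota 0 n', j <- iota 0 n'] ++ s'.
  move: eq_enc; move: (allpairs _ _ _ ++ s) (allpairs _ _ _ ++ s') => u u'.
  elim: n n' => [|n IH] [|n'] //= []; first by move->.
  by move/IH => [-> ->].
subst n'.
have /eqP : size [seq a i j | i <- iota 0 n, j <- iota 0 n] =
  size [seq a' i j | i <- iota 0 n, j <- iota 0 n] by rewrite !size_allpairs.
move=> eq_sz; move/eqP: eq_enc; rewrite eqseq_cat ?(eqP eq_sz) //.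
case/andP=> /eqP eq_mx /eqP ->; split=> // i j lt_i lt_j.
have /eq_in_map eq_rows : [seq [seq a i j | j <- iota 0 n] | i <- iota 0 n] =
    [seq [seq a' i j | j <- iota 0 n] | i <- iota 0 n].
  apply: eq_from_flatten_shape eq_mx _.
  by rewrite /shape -!map_comp; apply: eq_map => k /=; rewrite !size_map.
have in_n k : k < n -> k \in iota 0 n by rewrite mem_iota.
have /eq_in_map eq_row := eq_rows i (in_n i lt_i).
exact: eq_row (in_n j lt_j).
Qed.

Lemma eq_hom F G G' : nv G = nv G' ->
  (forall i j, i < nv G -> j < nv G -> adj G i j = adj G' i j) ->
  hom F G = hom F G'.
Proof.
case: G G' => n a [n' a'] /= eq_n; subst n' => eq_a.
apply: eq_card => f; rewrite !inE; apply: eq_forallb => i; apply: eq_forallb => j.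
by rewrite /= eq_a.
Qed.

(** * Equivalence over disjoint unions of cliques *)

Lemma HomInd_enc C G H : is_undirected G -> is_undirected H ->
  HomInd C (enc_graph G ++ enc_graph H) <-> hom_equiv C G H.
Proof.
move=> uG uH; split=> [[G' [H' [_ _ eq_enc equiv]]] | equiv]; last by exists G, H.
have [nG eq_H aG] := enc_graph_inj eq_enc.
have [|nH _ aH] := @enc_graph_inj H H' [::] [::]; first by rewrite !cats0.
by move=> F CF; rewrite (eq_hom F nG aG) (eq_hom F nH aH) equiv.
Qed.

Lemma hom_dunion F1 F2 G : hom (dunion F1 F2) G = hom F1 G * hom F2 G.
Proof.
pose T n := {ffun 'I_n -> 'I_(nv G)}.
pose split_fun (f : T (nv F1 + nv F2)) : T (nv F1) * T (nv F2) :=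
  ([ffun i => f (lshift _ i)], [ffun i => f (rshift _ i)]).
pose join_fun (g : T (nv F1) * T (nv F2)) : T (nv F1 + nv F2) :=
  [ffun i => match split i with inl j => g.1 j | inr j => g.2 j end].
have splitK : cancel split_fun join_fun.
  move=> f; apply/ffunP => i; rewrite ffunE.
  by case: splitP => j def_i; rewrite ffunE; congr (f _); apply: val_inj.
have joinK : cancel join_fun split_fun.
  move=> [g h]; congr (_, _); apply/ffunP => i; rewrite !ffunE.
    by rewrite -[lshift _ _]/(unsplit (inl _)) unsplitK.
  by rewrite -[rshift _ _]/(unsplit (inr _)) unsplitK.
rewrite /hom -cardsX -(on_card_preimset (f := split_fun)); last first.
  by apply: onW_bij; exists join_fun.
apply: eq_card => f; rewrite !inE; apply/idP/andP => [/forallP H|[/forallP H1 /forallP H2]].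
  split; apply/forallP => i; apply/forallP => j; apply/implyP => adj_ij; rewrite !ffunE.
    have /forallP/(_ (lshift _ j))/implyP := H (lshift _ i); apply.
    by rewrite /= !ltn_ord.
  have /forallP/(_ (rshift _ j))/implyP := H (rshift _ i); apply.
  by rewrite /= ltnNge !leq_addr /= !addKn.
apply/forallP => i; apply/forallP => j; apply/implyP => /=.
case: (splitP i) => i' def_i; case: (splitP j) => j' def_j //=.
- have eq_i : i = lshift (nv F2) i' by apply: val_inj.
  have eq_j : j = lshift (nv F2) j' by apply: val_inj.
  by have /forallP/(_ j')/implyP := H1 i'; rewrite !ffunE def_i def_j eq_i eq_j.
- by rewrite leqNgt def_j ltn_ord.
- have eq_i : i = rshift (nv F1) i' by apply: val_inj.
  have eq_j : j = rshift (nv F1) j' by apply: val_inj.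
  have /forallP/(_ j')/implyP := H2 i'.
  by rewrite !ffunE def_i def_j !addKn leq_addr eq_i eq_j.
Qed.

Lemma hom_nv0 F G : nv F = 0 -> hom F G = 1.
Proof.
case: F => n a /= n0; subst n; rewrite /hom (_ : [set f | _] = setT).
  by rewrite cardsT card_ffun !card_ord expn0.
by apply/setP => f; rewrite !inE; apply/forallP => -[].
Qed.

(** Homomorphism numbers multiply over the components, so single cliques decide; the factor of
    [empty_graph] is 1. *)
Lemma hom_equiv_KS S G H :
  hom_equiv (in_KS S) G H <-> (forall m, S m -> hom (K m) G = hom (K m) H).
Proof.
split=> [equiv m Sm | eq_hom F [ns [nsS ->]]].
  have := equiv (clique_sum [:: m]); rewrite /= !hom_dunion !(@hom_nv0 empty_graph) // !muln1.
  by apply; exists [:: m]; split=> // k; rewrite inE => /eqP->.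
elim: ns nsS => [|m ns IH] nsS; first by rewrite !hom_nv0 //.
rewrite /= !hom_dunion eq_hom ?IH // => [k k_in|]; apply: nsS; rewrite inE ?k_in ?orbT //.
by rewrite eqxx.
Qed.

Lemma hom_equiv_separating (S : nat -> Prop) G H n :
  (forall m, hom (K m) G = hom (K m) H <-> m <> n) ->
  hom_equiv (in_KS S) G H <-> ~ S n.
Proof.
move=> sep; rewrite hom_equiv_KS; split=> [eq_hom Sn | nSn m Sm].
  by have /sep := eq_hom n Sn; apply.
by apply/sep => eq_mn; apply: nSn; rewrite -eq_mn.
Qed.

Lemma hom_clique_one m :
  hom (K m) empty_graph = hom (K m) (K 1) <-> m <> 1.
Proof.
have H0 : hom (K m) empty_graph = (m == 0).
  case: m => [|m]; first by rewrite hom_nv0.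
  by apply/eqP; rewrite cards_eq0; apply/eqP/setP => f; case: (f ord0).
have H1 : hom (K m) (K 1) = (m <= 1).
  rewrite /hom; case: leqP => lt_m.
    rewrite (_ : [set f | _] = setT); first by rewrite cardsT card_ffun !card_ord exp1n.
    apply/setP => f; rewrite !inE; apply/forallP => i; apply/forallP => j.
    by have := ltn_ord i; have := ltn_ord j; rewrite /=; lia.
  apply/eqP; rewrite cards_eq0; apply/eqP/setP => f; rewrite !inE; apply/negP.
  move/forallP/(_ (Ordinal (ltnW lt_m)))/forallP/(_ (Ordinal lt_m))/implyP/(_ isT).
  by rewrite !ord1.
by rewrite H0 H1; lia.
Qed.

Theorem theorem37 (S : nat -> Prop) :
  poly_reducible (NotIn S) (HomInd (in_KS S)).
Proof.
have notin n : NotIn S (nseq n true) <-> ~ S n.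
  split=> [[n' [eq_n nS]]|nS]; last by exists n.
  by have := congr1 size eq_n; rewrite !size_nseq => ->.
(* The bit depends on [S] alone, so it may be chosen by excluded middle and built into the
   machine. *)
have [z zP] : exists z : bool, z <-> ~ S 0.
  by case: (classic (S 0)) => S0; [exists false | exists true]; split.
exists (reduction z); split; first exact: reduction_poly_time.
move=> x; rewrite /reduction; case: eqP => [->|not_ones]; last first.
  split=> [[n [def_x _]]|[G [H [_ _]]]].
    by case: not_ones; rewrite {2}def_x size_nseq.
  (* Every encoding contains the delimiter [false], so the empty word is none. *)
  by rewrite /enc_graph; case: (nv G).
rewrite size_nseq notin; case: (size x) => [|[|b]].
- have -> : (if z then [:: false; false] else [::]) =
    if z then enc_graph empty_graph ++ enc_graph empty_graph else [::] by [].
  rewrite -zP; case: z {zP}; first by rewrite HomInd_enc.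
  by split=> // -[G [H [_ _]]]; rewrite /enc_graph; case: (nv G).
- have -> : [:: false; true; false; false] = enc_graph empty_graph ++ enc_graph (K 1).
    by [].
  rewrite HomInd_enc //; last by move=> i j _ _ /=; rewrite eq_sym.
  by rewrite (hom_equiv_separating _ hom_clique_one).
- rewrite reduct_strE HomInd_enc; try exact: cut_graph_undirected.
  by rewrite (hom_equiv_separating _ (hom_clique_cut b)).
Qed.
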